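(* Let $(V_1,\ldots,V_n)$ be a pure tuple of commuting isometries on a Hilbert space $\mathcal{H}$ (that is, the $V_k$ are commuting isometries and $V=\prod_{k=1}^n V_k$ is a pure isometry on $\mathcal{H}$). Then for any $j\in\{1,\ldots,n\}$, $V_j$ is a pure isometry if and only if the fringe operator $F_{V_j}$ is a pure contraction on $\mathcal{H}\ominus \hat V_j\mathcal{H}$.
   Context: All Hilbert spaces are complex. A contraction $T$ (bounded operator with $\|T\|\le 1$) on a Hilbert space $\mathcal{H}$ is called pure if $\|T^{*m}h\|\to 0$ as $m\to\infty$ for every $h\in\mathcal{H}$; a pure isometry is an isometry that is a pure contraction. For a commuting tuple of isometries $(V_1,\ldots,V_n)$ on $\mathcal{H}$ put $\hat V_j:=\prod_{k=1,\,k\ne j}^n V_k$, and let $\mathcal{H}\ominus\hat V_j\mathcal{H}$ be the orthogonal complement of the closed subspace $\hat V_j\mathcal{H}$ in $\mathcal{H}$. The fringe operator with respect to $V_j$ is $F_{V_j}:=P_{\mathcal{H}\ominus\hat V_j\mathcal{H}}\,V_j|_{\mathcal{H}\ominus\hat V_j\mathcal{H}}:\mathcal{H}\ominus\hat V_j\mathcal{H}\to\mathcal{H}\ominus\hat V_j\mathcal{H}$, where $P_{\mathcal{H}\ominus\hat V_j\mathcal{H}}$ is the orthogonal projection onto $\mathcal{H}\ominus\hat V_j\mathcal{H}$. *)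

(* Defs.v *)
From HB Require Import structures.
From mathcomp Require Import all_boot all_order all_algebra sesquilinear.
From mathcomp Require Import complex.
From mathcomp Require Import boolp classical_sets reals topology normedtype.

Set Implicit Arguments.
Unset Strict Implicit.
Unset Printing Implicit Defensive.

Import Order.TTheory GRing.Theory Num.Theory.
Import numFieldNormedType.Exports.

Local Open Scope classical_set_scope.
Local Open Scope ring_scope.
Local Open Scope complex_scope.

(* The norm of x : H takes its values in R[i], as always for a normedModType
   over R[i]; the order of R[i] compares only numbers that differ by a real.
   Forms of type {dot H for conj} are linear in the first argument and
   conjugate-linear in the second. *)
HB.mixin Record isHilbert (R : realType) H & CompleteNormedModule R[i] H := {
  inner_form : {dot H for @Num.conj R[i]} ;
  sqr_norm_inner_form : forall x : H, `|x| ^+ 2 = inner_form x x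
}.

#[short(type="hilbertType")]
HB.structure Definition Hilbert (R : realType) :=
  {H of CompleteNormedModule R[i] H & isHilbert R H}.

Definition inner (R : realType) (H : hilbertType R) (x y : H) : R[i] :=
  inner_form x y.

Section InnerTheory.
Variables (R : realType) (H : hilbertType R).
Implicit Types x y z : H.

Lemma innerDl x y z : inner (x + y) z = inner x z + inner y z.
Proof. exact: linearDl. Qed.

Lemma innerZl a x z : inner (a *: x) z = a * inner x z.
Proof. exact: linearZl_LR. Qed.

Lemma innerC x y : inner x y = Num.conj (inner y x).
Proof.
have := @hermitian_subproof _ _ _ _ (@inner_form R H) x y.
by rewrite expr0 mul1r.
Qed.

Lemma sqr_norm_inner x : `|x| ^+ 2 = inner x x.
Proof. exact: sqr_norm_inner_form. Qed.

Lemma inner0l x : inner 0 x = 0.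
Proof. by rewrite -(scale0r 0) innerZl mul0r. Qed.

Lemma innerDr x y z : inner z (x + y) = inner z x + inner z y.
Proof. by rewrite innerC innerDl rmorphD /= -!innerC. Qed.

Lemma innerZr a x z : inner z (a *: x) = Num.conj a * inner z x.
Proof. by rewrite innerC innerZl rmorphM /= -innerC. Qed.

Lemma innerBl x y z : inner (x - y) z = inner x z - inner y z.
Proof. by rewrite innerDl -scaleN1r innerZl mulN1r. Qed.

Lemma innerBr x y z : inner z (x - y) = inner z x - inner z y.
Proof. by rewrite innerC innerBl rmorphB /= -!innerC. Qed.

Lemma inner_ge0 x : 0 <= inner x x.
Proof. by rewrite -sqr_norm_inner exprn_ge0. Qed.

Lemma inner_Cauchy_Schwarz x y : `|inner x y| <= `|x| * `|y|.
Proof.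
have [->|y0] := eqVneq y 0.
  by rewrite innerC inner0l rmorph0 !normr0 mulr0.
have yy0 : 0 < inner y y by rewrite -sqr_norm_inner exprn_gt0// normr_gt0.
rewrite -(@ler_pXn2r _ 2)// ?nnegrE ?mulr_ge0// exprMn !sqr_norm_inner.
rewrite -ler_pdivrMr// -subr_ge0.
have := inner_ge0 (x - (inner x y / inner y y) *: y).
rewrite innerBl !innerBr !innerZl !innerZr rmorphM fmorphV /= -!innerC.
rewrite divfK ?gt_eqF// subrr subr0.
by rewrite [inner y x]innerC [_ / _ * _]mulrAC [_^* * _]mulrC -normCK.
Qed.

End InnerTheory.

Section OrthogonalComplement.
Variables (R : realType) (H : hilbertType R) (A : set H).

Definition orthoc : {pred H} :=
  [pred x | `[< forall a, A a -> inner x a = 0 >]].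

Lemma orthocP x : reflect (forall a, A a -> inner x a = 0) (x \in orthoc).
Proof. exact: asboolP. Qed.

Fact orthoc_submod_closed : submod_closed orthoc.
Proof.
split=> [|a x y /orthocP xA /orthocP yA]; apply/orthocP => b Ab.
  exact: inner0l.
by rewrite innerDl innerZl xA// yA// mulr0 addr0.
Qed.

HB.instance Definition _ :=
  GRing.isSubmodClosed.Build R[i] H orthoc orthoc_submod_closed.

(* The orthogonal complement H (-) A as a Hilbert space of its own, with the
   operations, norm and inner product of H. *)
Record ortho_compl := OrthoCompl {
  ortho_val :> H ;
  ortho_valP : ortho_val \in orthoc
}.

HB.instance Definition _ := [isSub for ortho_val].
HB.instance Definition _ := [Choice of ortho_compl by <:].
HB.instance Definition _ := [SubChoice_isSubLmodule of ortho_compl by <:].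

Implicit Types x y z : ortho_compl.

Let norm x : R[i] := `|val x|.

Let norm_triangle x y : norm (x + y) <= norm x + norm y.
Proof. exact: ler_normD. Qed.

Let norm_scale (a : R[i]) x : norm (a *: x) = `|a| * norm x.
Proof. exact: normrZ. Qed.

Let norm_eq0 x : norm x = 0 -> x = 0.
Proof. by move=> /normr0_eq0 x0; exact: val_inj. Qed.

HB.instance Definition _ := @Lmodule_isNormed.Build R[i] ortho_compl norm
  norm_triangle norm_scale norm_eq0.

Let complete (F : set_system ortho_compl) : ProperFilter F -> cauchy F -> cvg F.
Proof.
move=> FF /cauchy_ballP F_cauchy.
have vF_cauchy : cauchy (val @ F : set_system H).
  apply/cauchy_ballP => e e0; have := F_cauchy e e0.
  case=> -[P Q] /= [FP FQ] PQ.
  exists (val @` P, val @` Q) => /=.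
    split; rewrite /nbhs/=.
      by apply: filterS FP => x Px; exists x.
    by apply: filterS FQ => x Qx; exists x.
  move=> [_ _] /= [[x Px <-] [y Qy <-]].
  have := PQ (x, y) (conj Px Qy).
  by rewrite -!ball_normE.
have /cvg_ex[l Fl] : cvg (val @ F : set_system H) by exact: cauchy_cvg.
have lA : l \in orthoc.
  apply/orthocP => a Aa; apply/eqP; rewrite -normr_le0.
  apply/ler_addgt0Pr => e e0; rewrite add0r.
  have e'0 : 0 < e / (`|a| + 1) by rewrite divr_gt0// ltr_wpDl.
  have /cvgrPdist_lt/(_ _ e'0) Fe := Fl.
  have [x lx] := filter_ex Fe.
  have -> : inner l a = inner (l - val x) a.
    by rewrite innerBl (orthocP _ (ortho_valP x))// subr0.
  apply: le_trans (inner_Cauchy_Schwarz _ _) _.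
  have -> : e = e / (`|a| + 1) * (`|a| + 1).
    by rewrite divfK// gt_eqF// ltr_wpDl.
  by apply: ler_pM => //; [exact: ltW|rewrite lerDl].
apply/cvg_ex; exists (OrthoCompl lA).
apply/cvgrPdist_lt => e e0.
by have /cvgrPdist_lt/(_ _ e0) := Fl.
Qed.

HB.instance Definition _ := Uniform_isComplete.Build ortho_compl complete.

Definition ortho_inner x y : R[i] := inner (val x) (val y).

Let ortho_inner_bilinear :
  bilinear_for *%R (@Num.conj R[i] \; *%R) ortho_inner.
Proof.
split=> z a x y; first by rewrite /ortho_inner /= innerDl innerZl.
by rewrite /ortho_inner /= innerDr innerZr.
Qed.

HB.instance Definition _ := bilinear_isBilinear.Build R[i] ortho_compl
  ortho_compl R[i] _ _ ortho_inner ortho_inner_bilinear.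

Let ortho_inner_hermitian x y :
  ortho_inner x y = (-1) ^+ false * Num.conj (ortho_inner y x).
Proof. by rewrite expr0 mul1r -innerC. Qed.

HB.instance Definition _ := isHermitianSesquilinear.Build R[i] ortho_compl
  false (@Num.conj R[i]) ortho_inner ortho_inner_hermitian.

Let ortho_inner_gt0 x : x != 0 -> 0 < ortho_inner x x.
Proof.
by move=> x0; rewrite /ortho_inner -sqr_norm_inner exprn_gt0// normr_gt0.
Qed.

HB.instance Definition _ := isDotProduct.Build R[i] ortho_compl ortho_inner
  ortho_inner_gt0.

Let ortho_sqr_norm x : `|x| ^+ 2 = ortho_inner x x.
Proof. exact: sqr_norm_inner. Qed.

HB.instance Definition _ := isHilbert.Build R ortho_compl ortho_sqr_norm.

End OrthogonalComplement.
Arguments ortho_compl {R H} A.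

Section Operators.
Variables (R : realType) (H : hilbertType R).
Implicit Types T V : H -> H.

(* T^* y is the vector z such that <T x, y> = <x, z> for all x; it exists and
   is unique for every bounded operator T, by the Riesz representation theorem
   (the value 0 of xget is never used then). *)
Definition adjoint T : H -> H :=
  fun y => xget 0 [set z | forall x, inner (T x) y = inner x z].

(* For a linear T, the bound says that T is bounded with operator norm <= 1. *)
Definition is_linear_contraction T := linear T /\ forall x, `|T x| <= `|x|.

Definition is_pure_contraction T :=
  is_linear_contraction T /\
  forall h, iter m (adjoint T) h @[m --> \oo] --> (0 : H).

Definition is_isometry V := linear V /\ forall x, `|V x| = `|x|.

Definition is_pure_isometry V := is_isometry V /\ is_pure_contraction V.

(* The orthogonal projection of H onto H (-) A, as a map into the space
   H (-) A: it sends x to the unique k in H (-) A such that x - k is orthogonal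
   to H (-) A (the value 0 of xget is never used, since H (-) A is closed). *)
Definition ortho_proj (A : set H) : H -> ortho_compl A :=
  fun x => xget 0
    [set k : ortho_compl A | forall l : ortho_compl A,
        inner (x - val k) (val l) = 0].

End Operators.

Section FringeOperator.
Variables (R : realType) (H : hilbertType R) (n : nat) (V : 'I_n -> H -> H).
Implicit Type j : 'I_n.

Definition prodV : H -> H := \big[comp/id]_(k < n) V k.

Definition hatV j : H -> H := \big[comp/id]_(k < n | k != j) V k.

Definition fringe j :
    ortho_compl (range (hatV j)) -> ortho_compl (range (hatV j)) :=
  fun x => ortho_proj (range (hatV j)) (V j (val x)).

Definition pure_commuting_isometries :=
  [/\ forall k, is_isometry (V k),
      forall k l x, V k (V l x) = V l (V k x) &
      is_pure_isometry prodV].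

End FringeOperator.
Arguments hatV {R H n} V j.
Arguments fringe {R H n} V j.

(* Main.v *)
(* Write W = V_j, U = hat V_j, so that V = W U. The adjoint of the fringe
   operator is the restriction of W* to ker U*, which gives one direction.
   For the other, let S be the intersection of the ranges of the W^m; W is pure
   as soon as S = 0. If y = W^m y_m lies in S and x in ker U*, then
   |<y, x>| = |<y_m, W*^m x>| <= |y| |W*^m x| -> 0, so S is orthogonal to
   ker U*, i.e. contained in U H. Then S is invariant under U* and W*, and
   V* = U* W* is isometric on S; as V is pure, S = 0. *)

Require Import Defs.
From mathcomp Require Import all_boot all_order all_algebra.
From mathcomp Require Import complex ring lra.
From mathcomp Require Import boolp classical_sets reals topology.
From mathcomp Require Import normedtype sequences.

Set Implicit Arguments.
Unset Strict Implicit.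
Unset Printing Implicit Defensive.

Import Order.TTheory GRing.Theory Num.Theory.
Import numFieldNormedType.Exports.

Local Open Scope classical_set_scope.
Local Open Scope ring_scope.
Local Open Scope complex_scope.

(** * Squared norms and convergence in a Hilbert space *)

Section InnerProduct.
Variables (R : realType) (H : hilbertType R).
Implicit Types x y z : H.

Lemma inner_inj y z : (forall x, inner x y = inner x z) -> y = z.
Proof.
move=> yz; apply/eqP; rewrite -subr_eq0 -normr_eq0 -sqrf_eq0 sqr_norm_inner.
by rewrite innerBr !yz subrr.
Qed.

(** Valued in [R] rather than [R[i]], so that infima, monotone limits and [lra] apply. *)
Definition sqnorm x : R := complex.Re (inner x x).

Lemma inner_sqnorm x : inner x x = (sqnorm x)%:C.
Proof.
have := inner_ge0 x; rewrite /sqnorm; case: (inner x x) => a b.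
by rewrite lecE /= => /andP[/eqP-> _].
Qed.

Lemma normr_sqnorm x : `|x| ^+ 2 = (sqnorm x)%:C.
Proof. by rewrite sqr_norm_inner inner_sqnorm. Qed.

Lemma sqnorm_ge0 x : 0 <= sqnorm x.
Proof. by rewrite -lecR -inner_sqnorm inner_ge0. Qed.

Lemma sqnorm_parallelogram x y :
  sqnorm (x + y) + sqnorm (x - y) = 2 * sqnorm x + 2 * sqnorm y.
Proof.
rewrite /sqnorm innerBl !innerBr innerDl !innerDr.
move: (inner x x) (inner x y) (inner y x) (inner y y).
by move=> [? ?] [? ?] [? ?] [? ?] /=; ring.
Qed.

Lemma sqnormZ (a : R) x : sqnorm (a%:C *: x) = a ^+ 2 * sqnorm x.
Proof.
by rewrite /sqnorm innerZl innerZr; case: (inner x x) => b c /=; ring.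
Qed.

(** A Cauchy criterion shaped for two uses: minimising sequences, and sequences whose squared
    distances are differences of a convergent real sequence. *)
Lemma cvg_sqr_dist (u : nat -> H) (r : nat -> R) :
    r m @[m --> \oo] --> (0 : R) ->
    (forall m k, sqnorm (u m - u k) <= r m + r k) ->
  cvg (u m @[m --> \oo]).
Proof.
move=> r0 ur; apply: cauchy_cvg; apply/cauchy_ballP => e e0.
have [a a0 ->] : exists2 a : R, 0 < a & e = a%:C.
  case: e e0 => a b; rewrite ltcE /= => /andP[/eqP-> a0]; exists a => //.
have a20 : 0 < a ^+ 2 / 2 by rewrite divr_gt0// exprn_gt0.
have /cvgrPdist_lt/(_ _ a20)[N _ rN] := r0.
exists (u @` [set m | (N <= m)%N], u @` [set m | (N <= m)%N]) => /=.
  by split; exists N => // m Nm; exists m.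
move=> [_ _] /= [[m Nm <-] [k Nk <-]]; rewrite -ball_normE /ball_ /=.
rewrite -(@ltr_pXn2r _ 2) ?nnegrE// ?lecR ?ltW//.
rewrite normr_sqnorm -rmorphXn /= ltcR (le_lt_trans (ur _ _))//.
have := rN _ Nm; have := rN _ Nk; rewrite /= !sub0r !normrN.
by move=> /ltr_normlW ? /ltr_normlW ?; lra.
Qed.

Lemma cvg0_sqnorm (u : nat -> H) :
  u m @[m --> \oo] --> (0 : H) <-> sqnorm (u m) @[m --> \oo] --> (0 : R).
Proof.
split=> [/cvgrPdist_lt u0|/cvgrPdist_lt u0]; apply/cvgrPdist_lt => e e0.
  have /u0 : 0 < (Num.sqrt e)%:C by rewrite ltcR sqrtr_gt0.
  apply: filterS => m; rewrite !sub0r !normrN.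
  rewrite -(@ltr_pXn2r _ 2) ?nnegrE// ?lecR ?sqrtr_ge0//.
  rewrite normr_sqnorm -rmorphXn /= ltcR sqr_sqrtr ?ltW// => um.
  by rewrite ger0_norm ?sqnorm_ge0.
have [a a0 ->] : exists2 a : R, 0 < a & e = a%:C.
  case: e e0 => a b; rewrite ltcE /= => /andP[/eqP-> a0]; exists a => //.
have /u0 : 0 < a ^+ 2 by rewrite exprn_gt0.
apply: filterS => m; rewrite !sub0r !normrN ger0_norm ?sqnorm_ge0// => um.
rewrite -(@ltr_pXn2r _ 2) ?nnegrE// ?lecR ?ltW//.
by rewrite normr_sqnorm -rmorphXn /= ltcR.
Qed.

Lemma sqr_inner_le x y : `|inner x y| ^+ 2 <= (sqnorm x * sqnorm y)%:C.
Proof.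
rewrite rmorphM /= -!normr_sqnorm -exprMn ler_pXn2r ?nnegrE ?mulr_ge0//.
exact: inner_Cauchy_Schwarz.
Qed.

(** Cauchy-Schwarz with its defect: [c *: y] is the projection of [x] on the line of [y]. If
    subtracting multiples of [y] barely shortens [x], then [x] is almost orthogonal to [y]. *)
Lemma sqr_inner_proj x y : exists c : R[i],
  `|inner x y| ^+ 2 = ((sqnorm x - sqnorm (x - c *: y)) * sqnorm y)%:C.
Proof.
have [->|y0] := eqVneq y 0.
  by exists 0; rewrite innerC /sqnorm !inner0l !rmorph0 normr0 expr0n mulr0.
have yy0 : inner y y != 0 by rewrite -sqr_norm_inner sqrf_eq0 normr_eq0.
exists (inner x y / inner y y).
rewrite rmorphM rmorphB /= -!inner_sqnorm innerBl !innerBr !innerZl !innerZr.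
set c := _ / _; have cE : c * inner y y = inner x y by rewrite divfK.
rewrite [inner y x]innerC normCK -cE; ring.
Qed.

Lemma sqnorm_eq0 x : sqnorm x = 0 -> x = 0.
Proof.
move=> x0; apply/eqP; rewrite -normr_eq0 -sqrf_eq0 normr_sqnorm x0.
by rewrite rmorph0.
Qed.

Lemma sqnormB x y :
  sqnorm (x - y) = sqnorm x + sqnorm y - 2 * complex.Re (inner x y).
Proof.
rewrite /sqnorm innerBl !innerBr [inner y x]innerC.
by move: (inner x x) (inner x y) (inner y y) => [? ?] [? ?] [? ?] /=; ring.
Qed.

Lemma sqr_normr_le_cvg0 (a : R[i]) (r : nat -> R) :
  r m @[m --> \oo] --> (0 : R) -> (forall m, `|a| ^+ 2 <= (r m)%:C) -> a = 0.
Proof.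
move=> r0 ar; apply/eqP; rewrite -normr_eq0 -sqrf_eq0 -normr_le0 normrX.
rewrite normr_id -(rmorph0 (real_complex R)).
have aE : `|a| ^+ 2 = (complex.Re `|a| ^+ 2)%:C.
  by rewrite -[in LHS](RRe_real (normr_real a)) rmorphXn.
rewrite aE lecR; rewrite -(cvg_lim (@Rhausdorff R) r0).
apply: limr_ge; first by apply/cvg_ex; exists 0.
by apply: nearW => m; rewrite -lecR -aE.
Qed.

End InnerProduct.

(** * Adjoints, and their existence for isometries *)

Lemma adjoint_eq (R : realType) (H : hilbertType R) (T : H -> H) (y z : H) :
  (forall x, inner (T x) y = inner x z) -> adjoint T y = z.
Proof.
move=> Tyz; apply: inner_inj => x; rewrite -Tyz /adjoint.
by case: xgetP => [w _ <-//|/(_ z)].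
Qed.

Section Isometry.
Variables (R : realType) (H : hilbertType R) (W : H -> H).
Hypothesis Wisom : is_isometry W.
Implicit Types x y z : H.

Lemma isometryD x y : W (x + y) = W x + W y.
Proof. by have := Wisom.1 1 x y; rewrite !scale1r. Qed.

Lemma isometry0 : W 0 = 0.
Proof. by apply: (addrI (W 0)); rewrite -isometryD !addr0. Qed.

Lemma isometryZ a x : W (a *: x) = a *: W x.
Proof. by have := Wisom.1 a x 0; rewrite isometry0 !addr0. Qed.

Lemma isometryB x y : W (x - y) = W x - W y.
Proof. by rewrite isometryD -scaleN1r isometryZ scaleN1r. Qed.

Lemma sqnorm_isometry x : sqnorm (W x) = sqnorm x.
Proof. by apply/complexI; rewrite -!normr_sqnorm Wisom.2. Qed.

(** Polarisation: the norm of a difference determines real parts, and replacing [x] by ['i *: x]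
    turns imaginary parts into real ones. *)
Lemma inner_isometry x y : inner (W x) (W y) = inner x y.
Proof.
have Re_inner a b : complex.Re (inner (W a) (W b)) = complex.Re (inner a b).
  have := sqnorm_isometry (a - b); rewrite isometryB !sqnormB !sqnorm_isometry.
  lra.
have := Re_inner x y; have := Re_inner ('i *: x) y.
rewrite isometryZ !innerZl.
move: (inner (W x) (W y)) (inner x y) => [a b] [c d] /=.
by rewrite !mul0r !mul1r !sub0r => /oppr_inj -> ->.
Qed.

(* The representing vector is the minimiser of |y - W z|, which exists since
   minimising sequences are Cauchy by the parallelogram law. *)
Lemma isometry_adjoint_ex y : exists z, forall x, inner (W x) y = inner x z.
Proof.
pose f z := sqnorm (y - W z); pose d := inf (range f).
have f_inf : has_inf (range f).
  by split; [exists (f 0), 0|exists 0 => _ [z _ <-]; exact: sqnorm_ge0].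
have df z : d <= f z by apply: ge_inf; [exact: f_inf.2|exists z].
have /choice[u fu] : forall m, exists z, f z < d + m.+1%:R^-1.
  move=> m; have m0 : 0 < m.+1%:R^-1 :> R by rewrite invr_gt0.
  by have [_ [z _ <-] fz] := inf_adherent m0 f_inf; exists z.
have /cvg_ex[z uz] : cvg (u m @[m --> \oo]).
  apply: (@cvg_sqr_dist _ _ _ (fun m => 2 * m.+1%:R^-1)).
    rewrite -(mulr0 2); apply: cvgM; first exact: cvg_cst.
    exact: cvg_harmonic.
  move=> m k.
  (* Half the sum of the two vectors is [y - W z] at the midpoint [z], where [f] is at least [d];
     this bounds the difference. *)
  have := sqnorm_parallelogram (y - W (u k)) (y - W (u m)).
  have -> : (y - W (u k)) + (y - W (u m)) =
      2 *: (y - W (2^-1 *: (u m + u k))).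
    rewrite isometryZ isometryD scalerBr scalerA divff ?pnatr_eq0// scale1r.
    by rewrite scaler_nat mulr2n opprD addrACA [- W (u m) - _]addrC.
  have -> : (y - W (u k)) - (y - W (u m)) = W (u m - u k).
    by rewrite isometryB opprB addrC addrA subrK.
  rewrite -(rmorph_nat (real_complex R) 2) sqnormZ sqnorm_isometry.
  have := df ((2%:R%:C)^-1 *: (u m + u k)); have := fu m; have := fu k.
  rewrite -!/(f _); move: (f (_ *: _)) (f _) (f _) => a b c.
  by move: m.+1%:R^-1 k.+1%:R^-1 (sqnorm _) => ? ? ?; lra.
exists z => x; apply/eqP; rewrite -(inner_isometry x z) -subr_eq0 -innerBr.
rewrite innerC conjC_eq0; apply/eqP.
apply: (@sqr_normr_le_cvg0 _ _
  (fun m => 2 * (m.+1%:R^-1 + sqnorm (u m - z)) * sqnorm x)).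
  rewrite -(mul0r (sqnorm x)) -(mulr0 2) -[X in 2 * X]addr0.
  apply: cvgM; last exact: cvg_cst.
  apply: cvgM; first exact: cvg_cst.
  apply: cvgD; first exact: cvg_harmonic.
  by apply/cvg0_sqnorm; rewrite -(subrr z); apply: cvgB => //; exact: cvg_cst.
(* The first summand is almost orthogonal to [W x], because [f (u m)] is within [m.+1%:R^-1] of the
   infimum; the second tends to 0. *)
move=> m; have -> : y - W z = (y - W (u m)) + W (u m - z).
  by rewrite isometryB addrA subrK.
rewrite innerDl inner_isometry.
have [c] := sqr_inner_proj (y - W (u m)) (W x).
have := sqr_inner_le (u m - z) x.
have : sqnorm (y - W (u m)) - sqnorm (y - W (u m) - c *: W x) <= m.+1%:R^-1.
  have := df (u m + c *: x); have := fu m.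
  rewrite /f isometryD isometryZ opprD addrA.
  by move: m.+1%:R^-1 (sqnorm _) (sqnorm _) => ? ? ?; lra.
rewrite sqnorm_isometry; move: (inner _ _) (inner _ _) => p q le1 le2 le3.
have pq : `|p + q| ^+ 2 <= 2 * `|p| ^+ 2 + 2 * `|q| ^+ 2.
  rewrite -subr_ge0 (_ : _ - _ = `|p - q| ^+ 2) ?exprn_ge0//.
  by rewrite !normCK rmorphD rmorphB; ring.
apply: (le_trans pq); rewrite -mulrDr -mulrA rmorphM rmorph_nat.
rewrite [(_ + sqnorm _) * _]mulrDl rmorphD ler_pM2l// lerD// le3 lecR.
by apply: ler_wpM2r; rewrite ?sqnorm_ge0.
Qed.

Lemma adjointP x y : inner (W x) y = inner x (adjoint W y).
Proof.
have [z zP] := isometry_adjoint_ex y.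
by move: x; rewrite /adjoint; case: xgetP => [//|/(_ z)].
Qed.

Lemma adjoint_isometryK : cancel W (adjoint W).
Proof. by move=> y; apply: adjoint_eq => x; rewrite inner_isometry. Qed.

Lemma adjointl x y : inner (adjoint W x) y = inner x (W y).
Proof. by rewrite innerC -adjointP -innerC. Qed.

Lemma adjoint_linear : linear (adjoint W).
Proof.
move=> a x y; apply: adjoint_eq => z.
by rewrite !innerDr !innerZr !adjointP.
Qed.

(** Pythagoras: [W (adjoint W x)] is the projection of [x] on the range of [W], with the same norm
    as [adjoint W x]. *)
Lemma sqnorm_adjoint_split x :
  sqnorm x = sqnorm (adjoint W x) + sqnorm (x - W (adjoint W x)).
Proof.
by rewrite sqnormB sqnorm_isometry -adjointl /sqnorm; lra.
Qed.

Lemma sqnorm_adjoint_le x : sqnorm (adjoint W x) <= sqnorm x.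
Proof. by rewrite [leRHS]sqnorm_adjoint_split lerDl sqnorm_ge0. Qed.

Lemma adjoint_defect x : adjoint W (x - W (adjoint W x)) = 0.
Proof.
apply: adjoint_eq => y.
by rewrite innerBr inner_isometry adjointP subrr innerC inner0l rmorph0.
Qed.

(** The defect [x - W (adjoint W x)] is orthogonal to the range of [W], so its inner product with
    [x] is its own squared norm. This is the test used below for membership in a range. *)
Lemma inner_defect_eq0 x :
  inner x (x - W (adjoint W x)) = 0 -> x = W (adjoint W x).
Proof.
move=> x0; apply/eqP; rewrite -subr_eq0; apply/eqP/sqnorm_eq0.
rewrite /sqnorm innerBl x0 adjointP adjoint_defect.
by rewrite innerC inner0l rmorph0 subr0.
Qed.

Lemma isometry_iter m : is_isometry (iter m W).
Proof.
elim: m => [|m [lin nrm]]; first by split.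
split=> [a x y|x]; first by rewrite !iterS lin Wisom.1.
by rewrite iterS Wisom.2 nrm.
Qed.

End Isometry.

(** * Commuting pairs of isometries and compressions *)

Section IsometryPairs.
Variables (R : realType) (H : hilbertType R).
Implicit Types (W U : H -> H) (x y h : H).

Lemma isometry_comp W U :
  is_isometry W -> is_isometry U -> is_isometry (W \o U).
Proof.
move=> [Wl Wn] [Ul Un]; split=> [a x y|x] /=; first by rewrite Ul Wl.
by rewrite Wn Un.
Qed.

Lemma adjoint_comp W U y : is_isometry W -> is_isometry U ->
  adjoint (W \o U) y = adjoint U (adjoint W y).
Proof.
by move=> Wi Ui; apply: adjoint_eq => x; rewrite /= !adjointP.
Qed.

Lemma pure_isometryP W : is_isometry W ->
  is_pure_isometry W <->
  forall h, sqnorm (iter m (adjoint W) h) @[m --> \oo] --> (0 : R).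
Proof.
move=> Wi; split=> [[_ [_ W0]] h|W0]; first exact/cvg0_sqnorm.
split=> //; split; last by move=> h; apply/cvg0_sqnorm.
by split=> [|x]; [exact: Wi.1|rewrite Wi.2].
Qed.

Lemma mem_orthoc_range W x : is_isometry W ->
  (x \in orthoc (range W)) = (adjoint W x == 0).
Proof.
move=> Wi; apply/orthocP/eqP => [xW|Wx0 _ [y _ <-]].
  apply: adjoint_eq => y; rewrite innerC xW; last by exists y.
  by rewrite innerC inner0l.
by rewrite -adjointl// Wx0 inner0l.
Qed.

Lemma val_ortho_proj W x : is_isometry W ->
  val (ortho_proj (range W) x) = x - W (adjoint W x).
Proof.
move=> Wi; have xK : x - W (adjoint W x) \in orthoc (range W).
  apply/orthocP => _ [y _ <-].
  by rewrite innerBl inner_isometry// adjointl// subrr.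
rewrite /ortho_proj.
case: xgetP => [k _ kx|/(_ (OrthoCompl xK)) []]; last first.
  move=> l /=; rewrite opprB addrC subrK.
  by rewrite innerC (orthocP _ _ (valP l)) ?rmorph0//; eexists.
pose w := OrthoCompl xK; apply/eqP; rewrite -subr_eq0 -[_ - _]/(val (k - w)).
apply/eqP/sqnorm_eq0; rewrite /sqnorm.
(* Uniqueness of the projection: [k - w] lies in the complement, yet both terms on the right are
   orthogonal to the complement. *)
have kwE : val (k - w) = W (adjoint W x) - (x - val k).
  by rewrite -[LHS]/(val k - (x - W (adjoint W x))) !opprB addrCA.
rewrite [X in inner X _]kwE innerBl [inner (x - _) _]kx subr0.
by rewrite innerC (orthocP _ _ (valP (k - w))) ?rmorph0//; eexists.
Qed.

Lemma adjoint_iter W m y : is_isometry W ->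
  adjoint (iter m W) y = iter m (adjoint W) y.
Proof.
move=> Wi; apply: adjoint_eq => x; elim: m x y => //= m IH x y.
by rewrite adjointP// IH -iterSr.
Qed.

(* The projections W^m W*^m decrease strongly to the projection onto the
   intersection of the ranges of the W^m. *)
Lemma iter_adjoint_cvg W h : is_isometry W ->
  exists2 y, (iter m W (iter m (adjoint W) h) @[m --> \oo] --> y) &
    forall m, exists z, y = iter m W z.
Proof.
move=> Wi; pose q m := iter m W (iter m (adjoint W) h).
pose a m := sqnorm (iter m (adjoint W) h); pose d := inf (range a).
have a_dec : nonincreasing_seq a.
  by apply/nonincreasing_seqP => m; exact: sqnorm_adjoint_le.
have a_lb : has_lbound (range a) by exists 0 => _ [m _ <-]; exact: sqnorm_ge0.
have ad m : d <= a m by apply: ge_inf => //; exists m.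
(* The ranges of the iterates decrease, so [q k] is the projection of [q m] on a smaller
   subspace. *)
have q_dist m k : (m <= k)%N -> sqnorm (q m - q k) = a m - a k.
  move=> /subnKC <-; move: (k - m)%N => {}k.
  have Wm := isometry_iter Wi m; have Wk := isometry_iter Wi k.
  rewrite /q sqnormB !(sqnorm_isometry (isometry_iter Wi _)).
  rewrite [iter (m + k) W _]iterD inner_isometry// -adjointl// adjoint_iter//.
  by rewrite -iterD [(k + m)%N]addnC -/(sqnorm _) -!/(a _); lra.
have /cvg_ex[y qy] : cvg (q m @[m --> \oo]).
  apply: (@cvg_sqr_dist _ _ _ (fun m => a m - d)).
    rewrite -(subrr d); apply: cvgB; last exact: cvg_cst.
    exact: nonincreasing_cvgn.
  move=> m k; have := ad m; have := ad k; case: (leqP m k) => [mk|/ltnW km].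
    by rewrite q_dist//; lra.
  rewrite -opprB -scaleN1r -(rmorphN1 (real_complex R)) sqnormZ q_dist//; lra.
exists y => // k; exists (iter k (adjoint W) y).
have Wk := isometry_iter Wi k.
rewrite -adjoint_iter//; set x := iter k W _.
(* [y - x] is orthogonal to the range of [iter k W], which contains every [q (m + k)]; pass to the
   limit in [m]. *)
have yx0 : inner y (y - x) = 0.
  apply: (@sqr_normr_le_cvg0 _ _
      (fun m => sqnorm (q (m + k)%N - y) * sqnorm (y - x))).
    rewrite -(mul0r (sqnorm (y - x))); apply: cvgM; last exact: cvg_cst.
    rewrite (@cvg_shiftn k _ (fun m => sqnorm (q m - y))).
    by apply/cvg0_sqnorm; rewrite -(subrr y); apply: cvgB => //; exact: cvg_cst.
  move=> m; have qx : inner (q (m + k)%N) (y - x) = 0.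
    rewrite /q addnC iterD (adjointP Wk) adjoint_defect//.
    by rewrite innerC inner0l rmorph0.
  by rewrite -normrN -[- _]add0r -qx -innerBl; exact: sqr_inner_le.
exact: inner_defect_eq0.
Qed.

(** The vectors W^m W*^m h have the norms of W*^m h, and their limit lies in all ranges of the
    iterates, hence vanishes. *)
Lemma pure_isometry_shift W : is_isometry W ->
    (forall y, (forall m, exists z, y = iter m W z) -> y = 0) ->
  is_pure_isometry W.
Proof.
move=> Wi W0; apply/pure_isometryP => // h.
have [y hy /W0 y0] := iter_adjoint_cvg h Wi.
move: hy; rewrite y0 => /cvg0_sqnorm.
by under eq_fun do rewrite (sqnorm_isometry (isometry_iter Wi _)).
Qed.

Lemma eq0_shift_space W U : is_isometry W -> is_isometry U ->
    (forall x, W (U x) = U (W x)) -> is_pure_isometry (W \o U) ->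
    (forall x, adjoint U x = 0 ->
      sqnorm (iter m (adjoint W) x) @[m --> \oo] --> (0 : R)) ->
  forall y, (forall m, exists z, y = iter m W z) -> y = 0.
Proof.
move=> Wi Ui WU Vpure W0.
pose S y := forall m, exists z, y = iter m W z.
(* The defect of [y] lies in the kernel of [adjoint U], where the iterates of [adjoint W] tend to 0;
   moving W^m from [y] across the inner product makes it orthogonal to [y]. *)
have SU y : S y -> y = U (adjoint U y).
  move=> Sy; set x := U _; have yx0 : inner y (y - x) = 0.
    apply: (@sqr_normr_le_cvg0 _ _
        (fun m => sqnorm y * sqnorm (iter m (adjoint W) (y - x)))).
      rewrite -(mulr0 (sqnorm y)); apply: cvgM; first exact: cvg_cst.
      by apply: W0; exact: adjoint_defect.
    move=> m; have Wm := isometry_iter Wi m.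
    have [z yz] := Sy m; rewrite {1 3}yz adjointP// adjoint_iter//.
    rewrite sqnorm_isometry//; exact: sqr_inner_le.
  exact: inner_defect_eq0.
have SadjU y : S y -> S (adjoint U y).
  move=> Sy m; have [z yz] := Sy m; exists (adjoint U z).
  (* Cancel [iter m W] in [y = iter (m + k) W w]. Then [SU] also applies to [z], and commutation
     moves [U] outside. *)
  have Sz : S z.
    move=> k; have [w yw] := Sy (m + k)%N; exists w.
    apply: (can_inj (adjoint_isometryK (isometry_iter Wi m))).
    by rewrite -iterD -yw.
  have -> : y = U (iter m W (adjoint U z)).
    by rewrite yz {1}(SU z Sz); elim: m {yz} => //= m ->.
  by rewrite adjoint_isometryK.
have SadjW y : S y -> S (adjoint W y).
  move=> Sy m; have [z ->] := Sy m.+1; exists z.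
  by rewrite iterS adjoint_isometryK.
(* On [S] the vector [y] is in the range of [W], and [adjoint W y], again in [S], is in the range of
   [U]; neither adjoint loses norm. *)
have Viter y m : S y -> S (iter m (adjoint (W \o U)) y) /\
    sqnorm (iter m (adjoint (W \o U)) y) = sqnorm y.
  move=> Sy; elim: m => //= m [{}Sy <-]; move: (iter _ _ _) Sy => {}y Sy.
  rewrite adjoint_comp//; split; first exact/SadjU/SadjW.
  rewrite -(sqnorm_isometry Ui) -(SU _ (SadjW _ Sy)).
  by have [z ->] := Sy 1%N; rewrite /= adjoint_isometryK// sqnorm_isometry.
move=> y Sy; apply: sqnorm_eq0.
have /cvg0_sqnorm := Vpure.2.2 y.
under eq_fun do rewrite (Viter _ _ Sy).2.
by move=> /(cvg_lim (@Rhausdorff R)); rewrite lim_cst.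
Qed.

(** The fringe operator for an arbitrary pair; [fringe V j] is convertible to the case [W = V j],
    [U = hatV V j]. *)
Definition compression W U (x : ortho_compl (range U)) :
    ortho_compl (range U) :=
  ortho_proj (range U) (W (val x)).

Lemma iter_adjoint_compression W U m (x : ortho_compl (range U)) :
    is_isometry W -> is_isometry U -> (forall x, W (U x) = U (W x)) ->
  val (iter m (adjoint (@compression W U)) x) = iter m (adjoint W) (val x).
Proof.
move=> Wi Ui WU; elim: m => //= m <-; move: (iter _ _ _) => {}x.
(* The complement is the kernel of [adjoint U]; it is invariant under [adjoint W] since the adjoints
   commute as well. *)
have adjx : adjoint W (val x) \in orthoc (range U).
  rewrite mem_orthoc_range// -adjoint_comp//.
  rewrite (_ : W \o U = U \o W); last exact/funext.
  rewrite adjoint_comp//; have := valP x; rewrite mem_orthoc_range// => /eqP->.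
  by apply/eqP/adjoint_eq => y; rewrite !(innerC _ 0) !inner0l.
suff -> : adjoint (@compression W U) x = OrthoCompl adjx by [].
apply: adjoint_eq => y.
rewrite -[LHS]/(inner (val _) (val x)).
rewrite -[RHS]/(inner (val y) (adjoint W (val x))).
rewrite val_ortho_proj// innerBl adjointP//.
by rewrite [X in _ - X]innerC (orthocP _ _ (valP x)) ?rmorph0 ?subr0//; eexists.
Qed.

Lemma compression_contraction W U : is_isometry W -> is_isometry U ->
  is_linear_contraction (@compression W U).
Proof.
move=> Wi Ui; split=> [a x y|x].
  apply: val_inj; rewrite /compression.
  rewrite -[RHS]/(a *: val (ortho_proj (range U) (W (val x)))
    + val (ortho_proj (range U) (W (val y)))) !val_ortho_proj//.
  rewrite -[val _]/(a *: val x + val y) Wi.1 adjoint_linear// Ui.1.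
  by rewrite scalerBr opprD addrACA.
rewrite -(@ler_pXn2r _ 2) ?nnegrE// !normr_sqnorm lecR.
rewrite -[leRHS]/(sqnorm (val x)) -[leLHS]/(sqnorm (val _)) val_ortho_proj//.
rewrite -(sqnorm_isometry Wi (val x)) [leRHS](sqnorm_adjoint_split Ui).
by rewrite lerDr sqnorm_ge0.
Qed.

Lemma pure_isometry_compression W U : is_isometry W -> is_isometry U ->
    (forall x, W (U x) = U (W x)) -> is_pure_isometry (W \o U) ->
  is_pure_isometry W <-> is_pure_contraction (@compression W U).
Proof.
move=> Wi Ui WU Vpure.
have itE (x : ortho_compl (range U)) :
    (fun m => sqnorm (iter m (adjoint (@compression W U)) x)) =
    (fun m => sqnorm (iter m (adjoint W) (val x))).
  by apply/funext => m; rewrite -iter_adjoint_compression.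
split=> [/pure_isometryP W0|[_ F0]].
  split=> [|x]; first exact: compression_contraction.
  by apply/cvg0_sqnorm; rewrite itE; exact: W0.
apply: pure_isometry_shift => //.
apply: (eq0_shift_space Wi Ui WU Vpure) => x Ux0.
have xK : x \in orthoc (range U) by rewrite mem_orthoc_range// Ux0.
by rewrite -(itE (OrthoCompl xK)); exact/cvg0_sqnorm.
Qed.

End IsometryPairs.

(** * From tuples to pairs *)

Section Tuples.
Variables (R : realType) (H : hilbertType R) (n : nat) (V : 'I_n -> H -> H).

Lemma hatV_isometry j : (forall k, is_isometry (V k)) -> is_isometry (hatV V j).
Proof.
by move=> Vi; apply: big_rec => [|k W _]; [split|exact: isometry_comp].
Qed.

Hypothesis Vcomm : forall k l x, V k (V l x) = V l (V k x).

Lemma comm_big_comp j (s : seq 'I_n) (P : pred 'I_n) x :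
  V j ((\big[comp/id]_(k <- s | P k) V k) x) =
  (\big[comp/id]_(k <- s | P k) V k) (V j x).
Proof.
elim: s x => [|k s IH] x; first by rewrite !big_nil.
by rewrite !big_cons; case: ifP => // _; rewrite /= Vcomm IH.
Qed.

(** Induction on a duplicate-free list containing [j]: commutation brings [V j] to the front, and
    once [j] is the head, the filter [k != j] removes nothing from the tail. *)
Lemma prodV_hatV j : prodV V = V j \o hatV V j.
Proof.
rewrite /prodV /hatV; have := mem_index_enum j; have := index_enum_uniq 'I_n.
elim: (index_enum _) => // k s IH /= /andP[ks us]; rewrite inE !big_cons.
have [-> _|jk /= js] := eqVneq j k.
  congr (_ \o _); rewrite big_seq_cond [RHS]big_seq_cond; apply: eq_bigl => i.
  by case: eqP => [->|]; rewrite ?(negPf ks) ?andbT.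
by rewrite IH//; apply/funext => x; exact: Vcomm.
Qed.

End Tuples.

Theorem proposition3p1 (R : realType) (H : hilbertType R) (n : nat)
    (V : 'I_n -> H -> H) (hV : pure_commuting_isometries V) (j : 'I_n) :
  is_pure_isometry (V j) <-> is_pure_contraction (fringe V j).
Proof.
have [Vi Vcomm Vpure] := hV.
apply: pure_isometry_compression => //; first exact: hatV_isometry.
  by move=> x; exact: comm_big_comp.
by rewrite -prodV_hatV.
Qed.
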